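(* The permutation classes $\mathrm{Av}(2413,2134,1234)$ and $\mathrm{Av}(2413,2134,1324,12534)$ are Wilf-equivalent, i.e. for every $n\ge0$ they contain the same number of permutations of size $n$.
   Context: A permutation of size $n$ is a word containing each of $1,\dots,n$ exactly once. $\sigma$ contains $\pi$ if some (not necessarily consecutive) subsequence of $\sigma$ has the same relative order as $\pi$; otherwise $\sigma$ avoids $\pi$. $\mathrm{Av}(P)$ is the set of permutations avoiding every element of $P$. *)

(* Defs.v *)
From mathcomp Require Import all_boot.

Set Implicit Arguments.
Unset Strict Implicit.
Unset Printing Implicit Defensive.

(* A permutation of size n is the word of its values, a sequence of nats with
   letters 1, ..., n. *)
Definition is_permutation (s : seq nat) : bool := perm_eq s (iota 1 (size s)).

Definition same_relative_order (t p : seq nat) : bool :=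
  (size t == size p) &&
  [forall i : 'I_(size p), forall j : 'I_(size p),
     (nth 0 t i < nth 0 t j) == (nth 0 p i < nth 0 p j)].

(* The bit mask m selects the letters of the subsequence, so m ranges over all
   subsequences of s; see containsP. *)
Definition contains (s p : seq nat) : bool :=
  [exists m : (size s).-tuple bool, same_relative_order (mask m s) p].

Lemma containsP (s p : seq nat) :
  reflect (exists2 t, subseq t s & same_relative_order t p) (contains s p).
Proof.
apply: (iffP existsP) => [[m hm] | [t /subseqP [m /eqP sm ->] ht]].
  by exists (mask m s) => //; exact: mask_subseq.
by exists (Tuple sm).
Qed.

Definition avoids (s p : seq nat) : bool := ~~ contains s p.

Definition Av (P : seq (seq nat)) : pred (seq nat) :=
  [pred s | is_permutation s && all (avoids s) P].

(* permutations (iota 1 n) lists every permutation of size n exactly once. *)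
Definition class_count (C : pred (seq nat)) (n : nat) : nat :=
  count C (permutations (iota 1 n)).

Lemma mem_permutations_iota (s : seq nat) (n : nat) :
  (s \in permutations (iota 1 n)) = is_permutation s && (size s == n).
Proof.
rewrite mem_permutations /is_permutation; apply/idP/andP => [h | [h /eqP <-]//].
by have sz := perm_size h; rewrite size_iota in sz; rewrite sz eqxx.
Qed.

Definition wilf_equivalent (C D : pred (seq nat)) : Prop :=
  forall n : nat, class_count C n = class_count D n.

(* Main.v *)
(** Both classes are grown by inserting a new maximum.  Call a site of a
    permutation active when inserting the maximum there stays in the class.

    In Av(2413, 2134, 1234), let [j] (resp. [l]) be the number of active sites
    [i >= 2] such that the first entry is (resp. is not) the least of the first
    [i] entries.  The generating tree has the rules
      T(j,l) -> T(0,j+l+1), T(j+1,l), T(1,0)^j, S^l     and     S -> T(0,1), S,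
    where S stands for the nodes with exactly two active sites, the second one
    not being site 1.

    In Av(2413, 2134, 1324, 12534), a node is described by the length [p] of an
    increasing prefix, with active sites 0, 1, p-1, p, and by the number [r] of
    active sites beyond [p]; with q = min(p-1, 2) the rules are
      U(p,r) -> U(1,r+1+q), U(2,r) if p = 1
      U(p,r) -> U(1,r+1+q), U(2,0), U(3,r) if p = 2
      U(p,r) -> U(1,r+1+q), U(2,0), U(p,0), U(p+1,r) if p >= 3,
    each with r further children S, and S -> U(1,1), S.

    By induction on depth, the number of descendants is affine in the labels,
    with the same coefficients for T(j,l) and for U(p,r) with j = q, l = r. *)

Require Import Defs.
From mathcomp Require Import all_boot zify.

Set Implicit Arguments.
Unset Strict Implicit.
Unset Printing Implicit Defensive.

(** * Insertion of a new maximum into a word *)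

Definition ins (i : nat) (s : seq nat) : seq nat :=
  take i s ++ (size s).+1 :: drop i s.

Lemma size_ins i s : size (ins i s) = (size s).+1.
Proof. by rewrite size_cat /= addnS -size_cat cat_take_drop. Qed.

Lemma nth_ins i s x : i <= size s ->
  nth 0 (ins i s) x =
    if x == i then (size s).+1 else nth 0 s (x - (i < x)).
Proof.
move=> hi; rewrite nth_cat size_takel //.
case: (ltngtP x i) => [h|h|->]; last by rewrite subnn.
  by rewrite nth_take // subn0.
have [d ->] : exists d, x = (i + d).+1 by exists (x - i.+1); lia.
by rewrite subSn ?leq_addr //= nth_drop; congr (nth _ _ _); lia.
Qed.

(** Here [u] is the position in [s] of the entry found at [x]; it carries no information when that
    entry is the new maximum. The three disjuncts are linear constraints, so that after [case_ins]
    on every index of an occurrence [lia] can finish. *)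
Lemma ins_cases i s x : i <= size s -> exists u,
  [\/ [/\ x < i, u = x & nth 0 (ins i s) x = nth 0 s u],
      x = i /\ nth 0 (ins i s) x = (size s).+1
    | [/\ i <= u, x = u.+1 & nth 0 (ins i s) x = nth 0 s u]].
Proof.
move=> hi; rewrite nth_ins //; exists (x - (i < x)).
case: (ltngtP x i) => h /=; last by constructor 2.
  by constructor 1; rewrite subn0.
by constructor 3; split=> //; lia.
Qed.

(** * Patterns as inequalities between entries *)

Lemma contains_index (s p : seq nat) :
  contains s p <->
  exists2 x : seq nat, sorted ltn x && all (gtn (size s)) x &
    same_relative_order [seq nth 0 s i | i <- x] p.
Proof.
split=> [/containsP [_ /subseqP [m hm ->] h] | [x /andP [sx /allP ax] h]].
  exists (mask m (iota 0 (size s))); last by rewrite map_mask map_nth_iota0 // take_size.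
  rewrite (subseq_sorted ltn_trans (mask_subseq _ _) (iota_ltn_sorted _ _)) /=.
  by apply/allP=> i /mem_mask; rewrite mem_iota /=.
apply/containsP; exists [seq nth 0 s i | i <- x] => //.
suff sub : subseq x (iota 0 (size s)).
  by have := map_subseq (nth 0 s) sub; rewrite map_nth_iota0 // take_size.
(* A strictly increasing list is determined by its members, so [x] is a filter of [iota 0 (size s)]
   and hence a subsequence of it. *)
have -> : x = [seq i <- iota 0 (size s) | i \in x].
  apply: (irr_sorted_eq ltn_trans ltnn sx).
    exact: (sorted_filter ltn_trans _ (iota_ltn_sorted _ _)).
  move=> i; rewrite mem_filter mem_iota /= add0n.
  by case hi: (i \in x) => //=; have /= -> := ax _ hi.
exact: filter_subseq.
Qed.

Lemma same_relative_orderP (t p : seq nat) :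
  reflect (size t = size p /\ forall i j, i < size p -> j < size p ->
             (nth 0 t i < nth 0 t j) = (nth 0 p i < nth 0 p j))
          (same_relative_order t p).
Proof.
apply: (iffP andP) => [[/eqP ? /forallP h] | [? h]]; split=> //; last 2 first.
- exact/eqP.
- apply/forallP=> i; apply/forallP=> j; apply/eqP; exact: h.
by move=> i j hi hj; have /forallP /(_ (Ordinal hj)) /eqP := h (Ordinal hi).
Qed.

Lemma contains4 s a b c d : let p := [:: a; b; c; d] in
  contains s p <->
  exists x y z w, x < y < z /\ z < w < size s /\
    same_relative_order [:: nth 0 s x; nth 0 s y; nth 0 s z; nth 0 s w] p.
Proof.
move=> p; rewrite contains_index; split.
  move=> [x /andP [sx ax] h]; have [sz _] := same_relative_orderP _ _ h.
  move: sx ax h; rewrite size_map in sz.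
  case: x sz => [|x [|y [|z [|w [|]]]]] //= _ sx ax h.
  by exists x, y, z, w; split; [lia|split; [lia|]].
move=> [x [y [z [w [h1 [h2 h]]]]]]; exists [:: x; y; z; w] => //=; lia.
Qed.

Lemma contains5 s a b c d e : let p := [:: a; b; c; d; e] in
  contains s p <->
  exists x y z w v, x < y < z /\ z < w < v /\ v < size s /\
    same_relative_order
      [:: nth 0 s x; nth 0 s y; nth 0 s z; nth 0 s w; nth 0 s v] p.
Proof.
move=> p; rewrite contains_index; split.
  move=> [x /andP [sx ax] h]; have [sz _] := same_relative_orderP _ _ h.
  move: sx ax h; rewrite size_map in sz.
  case: x sz => [|x [|y [|z [|w [|v [|]]]]]] //= _ sx ax h.
  by exists x, y, z, w, v; split; [lia|split; [lia|split; [lia|]]].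
move=> [x [y [z [w [v [h1 [h2 [h3 h]]]]]]]]; exists [:: x; y; z; w; v] => //=; lia.
Qed.

Ltac relative_order :=
  split;
  [ let h := fresh "h" in
    move=> /same_relative_orderP [_ h];
    move: (h 0 1 erefl erefl) (h 0 2 erefl erefl) (h 0 3 erefl erefl)
          (h 1 2 erefl erefl) (h 1 3 erefl erefl) (h 2 3 erefl erefl)
          (h 1 0 erefl erefl) (h 2 0 erefl erefl) (h 3 0 erefl erefl)
          (h 2 1 erefl erefl) (h 3 1 erefl erefl) (h 3 2 erefl erefl) => /=; lia
  | move=> ?; apply/same_relative_orderP; split=> //;
    move=> [|[|[|[|?]]]] [|[|[|[|?]]]] //= _ _; lia ].

Lemma order2413 a b c d :
  same_relative_order [:: a; b; c; d] [:: 2; 4; 1; 3] <-> c < a < d /\ d < b.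
Proof. relative_order. Qed.

Lemma order2134 a b c d :
  same_relative_order [:: a; b; c; d] [:: 2; 1; 3; 4] <-> b < a < c /\ c < d.
Proof. relative_order. Qed.

Lemma order1234 a b c d :
  same_relative_order [:: a; b; c; d] [:: 1; 2; 3; 4] <-> a < b < c /\ c < d.
Proof. relative_order. Qed.

Lemma order1324 a b c d :
  same_relative_order [:: a; b; c; d] [:: 1; 3; 2; 4] <-> a < c < b /\ b < d.
Proof. relative_order. Qed.

Lemma order12534 a b c d e :
  same_relative_order [:: a; b; c; d; e] [:: 1; 2; 5; 3; 4] <->
  a < b < d /\ d < e < c.
Proof.
split=> [/same_relative_orderP [_ h] | h].
  move: (h 0 1 erefl erefl) (h 1 3 erefl erefl) (h 3 4 erefl erefl)
        (h 4 2 erefl erefl) => /=; lia.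
apply/same_relative_orderP; split=> // [[|[|[|[|[|?]]]]] [|[|[|[|[|?]]]]]] //= _ _; lia.
Qed.

(** * Counting by insertion of the maximum *)

Fixpoint descendants (C : pred (seq nat)) (m : nat) (s : seq nat) : nat :=
  if m is m'.+1 then
    \sum_(0 <= i < (size s).+1)
      if C (ins i s) then descendants C m' (ins i s) else 0
  else 1.

(** Removing the letter [n.+1] shows that every permutation of size [n.+1] is an insertion. The
    right-hand list has at most [(n+1)!] members, so this one inclusion already forces it to be
    duplicate-free with the same members. *)
Lemma permutations_ins n :
  perm_eq (permutations (iota 1 n.+1))
    [seq ins i s | s <- permutations (iota 1 n), i <- index_iota 0 n.+1].
Proof.
have sub : {subset permutations (iota 1 n.+1) <=
    [seq ins i s | s <- permutations (iota 1 n), i <- index_iota 0 n.+1]}.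
  move=> t; rewrite mem_permutations => ht.
  have mt : n.+1 \in t by rewrite (perm_mem ht) mem_iota; lia.
  have st : size t = n.+1 by rewrite (perm_size ht) size_iota.
  set i := index n.+1 t; set s := take i t ++ drop i.+1 t.
  have lti : i < size t by rewrite index_mem.
  have tE : t = take i t ++ n.+1 :: drop i.+1 t.
    by rewrite -{1}(nth_index 0 mt) -drop_nth // cat_take_drop.
  have ps : perm_eq s (iota 1 n).
    have e : iota 1 n.+1 = iota 1 n ++ [:: n.+1] by rewrite -[in LHS](addn1 n) iotaD add1n.
    move: ht; rewrite e tE -cat1s perm_catCA.
    by rewrite perm_sym perm_catC perm_cat2l perm_sym.
  have ss : size s = n by rewrite (perm_size ps) size_iota.
  apply/allpairsP; exists (s, i); split=> //=.
  - by rewrite mem_permutations.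
  - by rewrite mem_index_iota; lia.
  rewrite /ins ss {1}tE /s take_cat drop_cat size_takel ?ltnn ?subnn; last exact: ltnW.
  by rewrite take0 cats0 drop0.
have sz : size [seq ins i s | s <- permutations (iota 1 n), i <- index_iota 0 n.+1]
    <= size (permutations (iota 1 n.+1)).
  rewrite size_allpairs !size_permutations ?iota_uniq // !size_iota factS; lia.
have u := permutations_uniq (iota 1 n.+1).
apply: uniq_perm => //; first exact: leq_size_uniq u sub sz.
by have [] := uniq_min_size u sub sz.
Qed.

(** Because [C] is closed under removal of the maximum, a word outside [C] has no child in [C], and
    only the nodes of level [n] in [C] contribute to level [m + n]. *)
Lemma class_count_descendants (C : pred (seq nat)) :
  (forall i s, C (ins i s) -> C s) -> forall m n,
  class_count C (m + n) =
  \sum_(s <- permutations (iota 1 n) | C s) descendants C m s.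
Proof.
move=> hC; elim=> [|m IH] n; first by rewrite sum1_count.
rewrite addSnnS IH (perm_big _ (permutations_ins n)) big_mkcond.
rewrite big_allpairs_dep [RHS]big_mkcond /=; apply: eq_big_seq => s.
rewrite mem_permutations => /perm_size; rewrite size_iota => ss.
rewrite ss; case: ifPn => // hs; apply: big1 => i _.
by case: ifP => // /hC; rewrite (negbTE hs).
Qed.

Definition A : pred (seq nat) :=
  Av [:: [:: 2; 4; 1; 3]; [:: 2; 1; 3; 4]; [:: 1; 2; 3; 4]].
Definition B : pred (seq nat) :=
  Av [:: [:: 2; 4; 1; 3]; [:: 2; 1; 3; 4]; [:: 1; 3; 2; 4]; [:: 1; 2; 5; 3; 4]].

Lemma perm_ins i s : perm_eq (ins i s) ((size s).+1 :: s).
Proof. by rewrite /ins -cat1s perm_catCA /= perm_cons cat_take_drop. Qed.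

Lemma is_permutation_ins i s : is_permutation (ins i s) = is_permutation s.
Proof.
rewrite /is_permutation size_ins (permPl (perm_ins i s)).
rewrite -[in iota _ _](addn1 (size s)) iotaD add1n perm_sym perm_catC.
by rewrite perm_cons perm_sym.
Qed.

Lemma subseq_ins i s : subseq s (ins i s).
Proof. by rewrite -{1}(cat_take_drop i s) cat_subseq ?subseq_cons. Qed.

Lemma Av_ins P i s : Av P (ins i s) -> Av P s.
Proof.
rewrite /Av /= is_permutation_ins => /andP [-> /allP h] /=.
apply/allP => p /h; apply: contra => /containsP [t ht ho]; apply/containsP.
by exists t => //; exact: subseq_trans ht (subseq_ins i s).
Qed.

Lemma permutation_bound s x : is_permutation s -> nth 0 s x <= size s.
Proof.
move=> h; case: (ltnP x (size s)) => hx; last by rewrite nth_default.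
by have := mem_nth 0 hx; rewrite (perm_mem h) mem_iota add1n ltnS => /andP [].
Qed.

Lemma permutation_inj s x y : is_permutation s -> x < y < size s ->
  nth 0 s x <> nth 0 s y.
Proof.
move=> h hxy e; have u : uniq s by rewrite (perm_uniq h) iota_uniq.
have : x == y by rewrite -(nth_uniq 0 _ _ u) ?e ?eqxx //=; lia.
lia.
Qed.

(** * Active sites *)

(** The patterns 2134 and 1234 differ only in the order of their first two letters. Entries being
    distinct, avoiding both means that no entry exceeding two earlier ones is followed by a larger
    one. *)
Lemma AP s : A s <-> is_permutation s /\
  forall x y z w, x < y < z -> z < w < size s ->
  ~ (nth 0 s z < nth 0 s x < nth 0 s w /\ nth 0 s w < nth 0 s y) /\
  ~ (nth 0 s x < nth 0 s z /\ nth 0 s y < nth 0 s z /\ nth 0 s z < nth 0 s w).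
Proof.
rewrite /A /Av /= andbT; split.
  move=> /and4P [hp /negP h1 /negP h2 /negP h3]; split=> // x y z w hx hz.
  split=> h.
    by apply: h1; apply/contains4; exists x, y, z, w; rewrite order2413.
  have hxy : nth 0 s x <> nth 0 s y by apply: permutation_inj => //; lia.
  case: (ltngtP (nth 0 s x) (nth 0 s y)) => // hl.
    by apply: h3; apply/contains4; exists x, y, z, w; rewrite order1234; lia.
  by apply: h2; apply/contains4; exists x, y, z, w; rewrite order2134; lia.
move=> [-> h] /=; apply/and3P; split; apply/negP => /contains4.
- by move=> [x [y [z [w [hx [hz /order2413]]]]]]; have := h _ _ _ _ hx hz; lia.
- by move=> [x [y [z [w [hx [hz /order2134]]]]]]; have := h _ _ _ _ hx hz; lia.
- by move=> [x [y [z [w [hx [hz /order1234]]]]]]; have := h _ _ _ _ hx hz; lia.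
Qed.

Lemma BP s : B s <-> is_permutation s /\
  (forall x y z w, x < y < z -> z < w < size s ->
  ~ (nth 0 s z < nth 0 s x < nth 0 s w /\ nth 0 s w < nth 0 s y) /\
  ~ (nth 0 s y < nth 0 s x < nth 0 s z /\ nth 0 s z < nth 0 s w) /\
  ~ (nth 0 s x < nth 0 s z < nth 0 s y /\ nth 0 s y < nth 0 s w)) /\
  (forall x y z w v, x < y < z -> z < w < v -> v < size s ->
  ~ (nth 0 s x < nth 0 s y < nth 0 s w /\ nth 0 s w < nth 0 s v < nth 0 s z)).
Proof.
rewrite /B /Av /= andbT; split.
  move=> /and5P [hp /negP h1 /negP h2 /negP h3 /negP h4]; split=> //; split.
    move=> x y z w hx hz; split; [|split] => h.
    - by apply: h1; apply/contains4; exists x, y, z, w; rewrite order2413.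
    - by apply: h2; apply/contains4; exists x, y, z, w; rewrite order2134.
    - by apply: h3; apply/contains4; exists x, y, z, w; rewrite order1324.
  move=> x y z w v hx hz hv h.
  by apply: h4; apply/contains5; exists x, y, z, w, v; rewrite order12534.
move=> [-> [h h5]] /=; apply/and4P; split; apply/negP.
- by move=> /contains4 [x [y [z [w [hx [hz /order2413]]]]]]; have := h _ _ _ _ hx hz; lia.
- by move=> /contains4 [x [y [z [w [hx [hz /order2134]]]]]]; have := h _ _ _ _ hx hz; lia.
- by move=> /contains4 [x [y [z [w [hx [hz /order1324]]]]]]; have := h _ _ _ _ hx hz; lia.
move=> /contains5 [x [y [z [w [v [hx [hz [hv /order12534]]]]]]]].
by have := h5 _ _ _ _ _ hx hz hv; lia.
Qed.

Ltac case_ins x hi u := have [u [[? ? ->]|[? ->]|[? ? ->]]] := ins_cases x hi.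

(** An occurrence created by the insertion uses the new maximum as its largest letter. Either it is
    the final 4 of 2134 or 1234, with the other three letters before site [i], or it is the 4 of
    2413, with the 2 before the site and the 1 and 3 after it. *)
Lemma A_insP s i : A s -> i <= size s -> A (ins i s) <->
  (forall x y z, x < y < z -> z < i ->
     ~ (nth 0 s x < nth 0 s z /\ nth 0 s y < nth 0 s z)) /\
  (forall x y z, x < i <= y -> y < z < size s ->
     ~ (nth 0 s y < nth 0 s x < nth 0 s z)).
Proof.
move=> /AP [hp hA] hi.
have bd x : nth 0 s x < (size s).+1 by exact: permutation_bound.
rewrite AP is_permutation_ins size_ins; split=> [[_ h] | [h1 h2]].
  split=> x y z hx hz.
    have /(_ hx) := h x y z i; rewrite !nth_ins // eqxx; have := bd z.
    have [-> -> ->] : [/\ i < x = false, i < y = false & i < z = false] by split; lia.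
    have [-> -> ->] : [/\ x == i = false, y == i = false & z == i = false] by split; lia.
    rewrite !subn0; lia.
  (* Entries from site [i] on move one place to the right, whence [y.+1] and [z.+1]. *)
  have := h x i y.+1 z.+1; rewrite !nth_ins // eqxx; have := bd z.
  have [-> -> ->] : [/\ i < x = false, i < y.+1 & i < z.+1] by split; lia.
  have [-> -> ->] : [/\ x == i = false, y.+1 == i = false & z.+1 == i = false] by split; lia.
  rewrite subn0 !subn1 /=; lia.
split=> // x y z w hx hz.
(* Four old entries are handled by [hA]; the maximum in fourth place by [h1], in second place by
   [h2]; elsewhere it is too large. *)
case_ins x hi x1; case_ins y hi y1; try lia;
case_ins z hi z1; try lia; case_ins w hi w1; try lia;
move: (bd x1) (bd y1) (bd z1) (bd w1) (hA x1 y1 z1 w1) (h1 x1 y1 z1) (h2 x1 z1 w1);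
lia.
Qed.

(** The new maximum can be the last letter of 2134 or 1324 (first clause), the 4 of 2413 (second
    clause) or the 5 of 12534 (third clause). *)
Lemma B_insP s i : B s -> i <= size s -> B (ins i s) <->
  (forall x y z, x < y < z -> z < i ->
     ~ (nth 0 s y < nth 0 s x < nth 0 s z) /\
     ~ (nth 0 s x < nth 0 s z < nth 0 s y)) /\
  (forall x y z, x < i <= y -> y < z < size s ->
     ~ (nth 0 s y < nth 0 s x < nth 0 s z)) /\
  (forall x y z w, x < y < i -> i <= z < w -> w < size s ->
     ~ (nth 0 s x < nth 0 s y < nth 0 s z /\ nth 0 s z < nth 0 s w)).
Proof.
move=> /BP [hp [hB hB5]] hi.
have bd x : nth 0 s x < (size s).+1 by exact: permutation_bound.
rewrite BP is_permutation_ins size_ins; split=> [[_ [h h5]] | [h1 [h2 h3]]].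
  split; [|split].
  - move=> x y z hx hz.
    have /(_ hx) := h x y z i; rewrite !nth_ins // eqxx; move: (bd z) (bd y).
    have [-> -> ->] : [/\ i < x = false, i < y = false & i < z = false] by split; lia.
    have [-> -> ->] : [/\ x == i = false, y == i = false & z == i = false] by split; lia.
    rewrite !subn0; lia.
  - move=> x y z hx hz.
    have := h x i y.+1 z.+1; rewrite !nth_ins // eqxx; have := bd z.
    have [-> -> ->] : [/\ i < x = false, i < y.+1 & i < z.+1] by split; lia.
    have [-> -> ->] : [/\ x == i = false, y.+1 == i = false & z.+1 == i = false] by split; lia.
    rewrite subn0 !subn1 /=; lia.
  - move=> x y z w hx hz hw.
    have := h5 x y i z.+1 w.+1; rewrite !nth_ins // eqxx; have := bd w.
    have [-> ->] : i < x = false /\ i < y = false by lia.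
    have [-> ->] : i < z.+1 /\ i < w.+1 by lia.
    have [-> ->] : x == i = false /\ y == i = false by lia.
    have [-> ->] : z.+1 == i = false /\ w.+1 == i = false by lia.
    rewrite !subn0 !subn1 /=; lia.
split=> //; split.
  move=> x y z w hx hz.
  case_ins x hi x1; case_ins y hi y1; try lia;
  case_ins z hi z1; try lia; case_ins w hi w1; try lia;
  move: (bd x1) (bd y1) (bd z1) (bd w1) (hB x1 y1 z1 w1) (h1 x1 y1 z1) (h2 x1 z1 w1);
  lia.
move=> x y z w v hx hz hv.
case_ins x hi x1; case_ins y hi y1; try lia;
case_ins z hi z1; try lia; case_ins w hi w1; try lia; case_ins v hi v1; try lia;
move: (bd x1) (bd y1) (bd z1) (bd w1) (bd v1) (hB5 x1 y1 z1 w1 v1) (h3 x1 y1 w1 v1);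
lia.
Qed.

Lemma nth_ins_eq i s : i <= size s -> nth 0 (ins i s) i = (size s).+1.
Proof. by move=> hi; rewrite nth_ins // eqxx. Qed.

Lemma nth_ins_bump i s x : i <= size s ->
  nth 0 (ins i s) (x + (i <= x)) = nth 0 s x.
Proof.
move=> hi; rewrite nth_ins //; case: (leqP i x) => h; rewrite ?addn1 ?addn0.
  have [-> ->] : x.+1 == i = false /\ i < x.+1 by lia.
  by rewrite subn1.
have [-> ->] : x == i = false /\ i < x = false by lia.
by rewrite subn0.
Qed.

Lemma nth_ins_lt i s x : i <= size s -> x < i ->
  nth 0 (ins i s) x = nth 0 s x.
Proof. by move=> hi hx; rewrite -[RHS](nth_ins_bump x hi) leqNgt hx addn0. Qed.

Lemma nth_ins_gt i s x : i <= size s -> i <= x ->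
  nth 0 (ins i s) x.+1 = nth 0 s x.
Proof. by move=> hi hx; rewrite -[RHS](nth_ins_bump x hi) hx addn1. Qed.

Definition first_min (s : seq nat) (i : nat) : bool :=
  all (fun y => nth 0 s 0 <= nth 0 s y) (iota 0 i).

Lemma first_minP s i :
  reflect (forall y, y < i -> nth 0 s 0 <= nth 0 s y) (first_min s i).
Proof.
apply: (iffP allP) => h y; last by rewrite mem_iota add0n; exact: h.
by move=> hy; apply: h; rewrite mem_iota.
Qed.

Lemma A_perm s : A s -> is_permutation s. Proof. by case/andP. Qed.
Lemma B_perm s : B s -> is_permutation s. Proof. by case/andP. Qed.

(** * Active sites of a child *)

Lemma A_ins0 s : A s -> A (ins 0 s).
Proof. by move=> hs; apply/A_insP. Qed.

Lemma B_ins0 s : B s -> B (ins 0 s).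
Proof. by move=> hs; apply/B_insP => //; split=> //; split=> // x y z w; lia. Qed.

(** The previous maximum stands immediately after the new one: it is too large to act as the 1 of a
    2413, and no entry between the two is left to be that 1 when it acts as the 3. *)
Lemma A_ins_same s i : i <= size s -> A (ins i s) -> A (ins i (ins i s)).
Proof.
move=> hi hA; have hs := Av_ins hA; have [h1 h2] := (A_insP hs hi).1 hA.
have bd x : nth 0 s x < (size s).+1 by exact: permutation_bound (A_perm hs).
apply/A_insP; rewrite ?size_ins //; first by lia.
split=> x y z hx hz.
  by rewrite !nth_ins_lt //; [exact: h1|lia..].
case_ins x hi x1; try lia; case_ins y hi y1; try lia; case_ins z hi z1; try lia;
move: (bd x1) (bd y1) (bd z1) (h2 x1 y1 z1); lia.
Qed.

(** Only the first entry precedes site 1, so the danger is a 2413 with that entry as its 2. The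
    previous maximum at [i] serves as the 3, so every entry before [i] must exceed the first one; a
    1 located after [i] would already have blocked site [i] in [s]. *)
Lemma A_ins1 s i : 1 < i <= size s -> A (ins i s) ->
  A (ins 1 (ins i s)) = first_min s i.
Proof.
move=> hi2 hA; have hi : i <= size s by lia.
have hs := Av_ins hA; have [h1 h2] := (A_insP hs hi).1 hA.
have bd x : nth 0 s x < (size s).+1 by exact: permutation_bound (A_perm hs).
apply/idP/first_minP => [h y hy | h].
  have /A_insP [] // := h; rewrite ?size_ins // => _ /(_ 0 y i).
  rewrite nth_ins_eq // !nth_ins_lt //; last lia.
  have := bd 0; case: y hy => // y hy; lia.
apply/A_insP; rewrite ?size_ins //; split=> x y z hx hz; first lia.
have -> : x = 0 by lia.
rewrite (@nth_ins_lt i s 0) //; last lia.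
case_ins y hi y1; case_ins z hi z1; try lia;
move: (bd 0) (bd y1) (bd z1) (h2 0 y1 z1) (h y1); lia.
Qed.

(** If the entry at [j] is below one of the first two entries, that entry, the entry at [j] and the
    previous maximum act as 2, 1, 3 around the new maximum. Otherwise it exceeds both, which
    contradicts that site [i] is active in [s]. *)
Lemma A_ins_mid s i j : 1 < j < i -> i <= size s -> A (ins i s) ->
  A (ins j (ins i s)) = false.
Proof.
move=> hj hi hA; have hs := Av_ins hA; have [h1 h2] := (A_insP hs hi).1 hA.
have bd x : nth 0 s x < (size s).+1 by exact: permutation_bound (A_perm hs).
apply/negP => /A_insP [] //; rewrite ?size_ins; first lia.
move=> _ h; move: (h 0 j i) (h 1 j i) (h1 0 1 j).
rewrite nth_ins_eq // !nth_ins_lt //; try lia.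
have n0 : nth 0 s 0 <> nth 0 s j by apply: permutation_inj (A_perm hs) _; lia.
have n1 : nth 0 s 1 <> nth 0 s j by apply: permutation_inj (A_perm hs) _; lia.
move: (bd 0) (bd 1); lia.
Qed.

(** For [i >= 2] the previous maximum exceeds two earlier entries and precedes site [j.+1], which is
    fatal. For [i <= 1] it has at most one entry before it and creates no new obstruction. *)
Lemma A_ins_right s i j : i <= j <= size s -> A (ins i s) ->
  A (ins j.+1 (ins i s)) = (i <= 1) && A (ins j s).
Proof.
move=> hj hA; have hi : i <= size s by lia.
have hj' : j <= size s by lia.
have hs := Av_ins hA; have [h1 h2] := (A_insP hs hi).1 hA.
have bd x : nth 0 s x < (size s).+1 by exact: permutation_bound (A_perm hs).
apply/idP/andP => [/A_insP [] // | [i1 /A_insP [] // k1 k2]].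
- by rewrite size_ins.
- rewrite size_ins => k1 k2; split.
    rewrite leqNgt; apply/negP => i2.
    move: (k1 0 1 i); rewrite nth_ins_eq // !nth_ins_lt //; try lia.
    move: (bd 0) (bd 1); lia.
  apply/A_insP => //; split=> x y z hx hz.
    (* Obstructions in [s] are carried to [ins i s] along the increasing map sending [x] to
       [x + (i <= x)]. *)
    move: (k1 (x + (i <= x)) (y + (i <= y)) (z + (i <= z))).
    rewrite !nth_ins_bump //; lia.
  move: (k2 (x + (i <= x)) (y + (i <= y)) (z + (i <= z))).
  rewrite !nth_ins_bump //; lia.
apply/A_insP; rewrite ?size_ins //; split=> x y z hx hz.
  case_ins x hi x1; case_ins y hi y1; try lia; case_ins z hi z1; try lia;
  move: (bd x1) (bd y1) (bd z1) (k1 x1 y1 z1); lia.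
case_ins x hi x1; case_ins y hi y1; try lia; case_ins z hi z1; try lia;
move: (bd x1) (bd y1) (bd z1) (k2 x1 y1 z1); lia.
Qed.

Lemma B_ins_same s i : i <= size s -> B (ins i s) -> B (ins i (ins i s)).
Proof.
move=> hi hB; have hs := Av_ins hB; have [h1 [h2 h3]] := (B_insP hs hi).1 hB.
have bd x : nth 0 s x < (size s).+1 by exact: permutation_bound (B_perm hs).
apply/B_insP; rewrite ?size_ins //; first by lia.
split; [|split].
- move=> x y z hx hz; rewrite !nth_ins_lt //; [exact: h1|lia..].
- move=> x y z hx hz.
  case_ins x hi x1; try lia; case_ins y hi y1; try lia; case_ins z hi z1; try lia;
  move: (bd x1) (bd y1) (bd z1) (h2 x1 y1 z1); lia.
- move=> x y z w hx hz hw.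
  case_ins x hi x1; try lia; case_ins y hi y1; try lia;
  case_ins z hi z1; try lia; case_ins w hi w1; try lia;
  move: (bd x1) (bd y1) (bd z1) (bd w1) (h3 x1 y1 z1 w1); lia.
Qed.

Lemma B_ins1 s i : 1 < i <= size s -> B (ins i s) ->
  B (ins 1 (ins i s)) = first_min s i.
Proof.
move=> hi2 hB; have hi : i <= size s by lia.
have hs := Av_ins hB; have [h1 [h2 h3]] := (B_insP hs hi).1 hB.
have bd x : nth 0 s x < (size s).+1 by exact: permutation_bound (B_perm hs).
apply/idP/first_minP => [h y hy | h].
  have /B_insP [] // := h; rewrite ?size_ins // => _ [/(_ 0 y i)].
  rewrite nth_ins_eq // !nth_ins_lt //; last lia.
  have := bd 0; case: y hy => // y hy; lia.
apply/B_insP; rewrite ?size_ins //; split=> [x y z hx hz|]; first lia.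
split=> [x y z hx hz|x y z w hx hz hw]; last lia.
have -> : x = 0 by lia.
rewrite (@nth_ins_lt i s 0) //; last lia.
case_ins y hi y1; case_ins z hi z1; try lia;
move: (bd 0) (bd y1) (bd z1) (h2 0 y1 z1) (h y1); lia.
Qed.

(** An entry at [j] below one of the first two yields a 2413 ending in the previous maximum. If it
    exceeds both, then either the first two increase and give a 12534 ending in the previous
    maximum, or they decrease and form a 213 before site [i]. *)
Lemma B_ins_mid s i j : 1 < j < i -> i <= size s -> B (ins i s) ->
  B (ins j (ins i s)) = false.
Proof.
move=> hj hi hB; have hs := Av_ins hB; have [h1 [h2 h3]] := (B_insP hs hi).1 hB.
have bd x : nth 0 s x < (size s).+1 by exact: permutation_bound (B_perm hs).
apply/negP => /B_insP [] //; rewrite ?size_ins; first lia.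
move=> _ [h h']; move: (h 0 j i) (h 1 j i) (h' 0 1 j i) (h1 0 1 j).
rewrite nth_ins_eq // !nth_ins_lt //; try lia.
have n0 : nth 0 s 0 <> nth 0 s j by apply: permutation_inj (B_perm hs) _; lia.
have n1 : nth 0 s 1 <> nth 0 s j by apply: permutation_inj (B_perm hs) _; lia.
have n2 : nth 0 s 0 <> nth 0 s 1 by apply: permutation_inj (B_perm hs) _; lia.
move: (bd 0) (bd 1) (bd j); lia.
Qed.

(** The previous maximum now lies before the new site. It must not be the 3 of a 213, so the entries
    before [i] increase; nor the 3 of a 132, so the entries between the two maxima lie below all
    those before [i]. *)
Lemma B_ins_right s i j : i <= j <= size s -> B (ins i s) ->
  B (ins j.+1 (ins i s)) <->
  [/\ B (ins j s), forall x y, x < y < i -> nth 0 s x < nth 0 s y &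
      forall x y, x < i <= y -> y < j -> nth 0 s y < nth 0 s x].
Proof.
move=> hj hB; have hi : i <= size s by lia.
have hj' : j <= size s by lia.
have hs := Av_ins hB; have [h1 [h2 h3]] := (B_insP hs hi).1 hB.
have bd x : nth 0 s x < (size s).+1 by exact: permutation_bound (B_perm hs).
split=> [/B_insP [] // | [/B_insP [] // k1 [k2 k3] hinc hlt]].
- by rewrite size_ins.
- rewrite size_ins => k1 [k2 k3]; split.
  + apply/B_insP => //; split; [|split].
    * move=> x y z hx hz.
      move: (k1 (x + (i <= x)) (y + (i <= y)) (z + (i <= z))).
      rewrite !nth_ins_bump //; lia.
    * move=> x y z hx hz.
      move: (k2 (x + (i <= x)) (y + (i <= y)) (z + (i <= z))).
      rewrite !nth_ins_bump //; lia.
    * move=> x y z w hx hz hw.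
      move: (k3 (x + (i <= x)) (y + (i <= y)) (z + (i <= z)) (w + (i <= w))).
      rewrite !nth_ins_bump //; lia.
  + move=> x y hx; move: (k1 x y i); rewrite nth_ins_eq // !nth_ins_lt //; try lia.
    have n0 : nth 0 s x <> nth 0 s y by apply: permutation_inj (B_perm hs) _; lia.
    move: (bd x); lia.
  + move=> x y hx hy; move: (k1 x i y.+1).
    rewrite nth_ins_eq // nth_ins_lt // ?nth_ins_gt //; try lia.
    have n0 : nth 0 s x <> nth 0 s y by apply: permutation_inj (B_perm hs) _; lia.
    move: (bd y); lia.
apply/B_insP; rewrite ?size_ins //; split; [|split].
- move=> x y z hx hz.
  case_ins x hi x1; case_ins y hi y1; try lia; case_ins z hi z1; try lia;
  move: (bd x1) (bd y1) (bd z1) (k1 x1 y1 z1) (hinc x1 y1) (hlt x1 z1); lia.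
- move=> x y z hx hz.
  case_ins x hi x1; case_ins y hi y1; try lia; case_ins z hi z1; try lia;
  move: (bd x1) (bd y1) (bd z1) (k2 x1 y1 z1); lia.
- move=> x y z w hx hz hw.
  case_ins x hi x1; case_ins y hi y1; try lia;
  case_ins z hi z1; try lia; case_ins w hi w1; try lia;
  move: (bd x1) (bd y1) (bd z1) (bd w1) (k3 x1 y1 z1 w1); lia.
Qed.

(** * The two generating trees *)

Lemma big_nat_single a b k (F : nat -> nat) : a <= k < b ->
  (forall i, a <= i < b -> i != k -> F i = 0) -> \sum_(a <= i < b) F i = F k.
Proof.
move=> hk hF; rewrite (bigD1_seq k) ?mem_index_iota ?iota_uniq //=.
rewrite big1_seq ?addn0 // => i /andP [ne]; rewrite mem_index_iota => hi.
exact: hF.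
Qed.

Lemma big_nat_zero a b (F : nat -> nat) :
  (forall i, a <= i < b -> F i = 0) -> \sum_(a <= i < b) F i = 0.
Proof. by move=> hF; rewrite big1_seq // => i; rewrite mem_index_iota => /hF. Qed.

(** The sites 1, [p.-1] and [p] coincide for small [p]; the two tests prevent counting a site
    twice. *)
Lemma big_nat_run p (F : nat -> nat) : 0 < p ->
  (forall i, 1 < i < p.-1 -> F i = 0) ->
  \sum_(1 <= i < p.+1) F i =
    F 1 + (if 1 < p then F p else 0) + (if 2 < p then F p.-1 else 0).
Proof.
case: p => [|[|[|p]]] // _ hF; first by rewrite big_nat1 !addn0.
  by rewrite big_ltn // big_nat1 addn0.
rewrite big_ltn // big_nat_recr //= big_nat_recr //= big_nat_zero; first lia.
by move=> i hi; apply: hF.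
Qed.

Lemma first_min1 s : first_min s 1.
Proof. by rewrite /first_min /= leqnn. Qed.

Lemma first_min_ins0 s i : 0 < size s -> is_permutation s -> 1 < i ->
  first_min (ins 0 s) i = false.
Proof.
move=> hs hp hi; apply/negP => /first_minP /(_ _ hi).
by rewrite nth_ins_eq // nth_ins_gt // leqNgt ltnS permutation_bound.
Qed.

Lemma first_min_ins i s : i <= size s -> first_min (ins i s) i = first_min s i.
Proof.
move=> hi; apply/first_minP/first_minP => h y hy; have := h y hy;
  by rewrite !nth_ins_lt //; case: y hy => //; lia.
Qed.

Lemma first_min_ins1 s x : 0 < size s -> is_permutation s -> 0 < x ->
  first_min (ins 1 s) x.+1 = first_min s x.
Proof.
move=> hs hp hx; have bd := permutation_bound (s := s) _ hp.
apply/first_minP/first_minP => h y hy; last first.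
  case: y hy => [|[|y]] // hy; first by rewrite nth_ins_eq // nth_ins_lt // ltnW // ltnS.
  by rewrite nth_ins_lt // nth_ins_gt //; apply: h.
case: y hy => [|y] // hy; have := h y.+2 hy.
by rewrite nth_ins_lt // nth_ins_gt.
Qed.

(** These are the nodes S. The failure of [first_min] at [k] keeps site 1 inactive in the child at
    [k], which is therefore again a node S. *)
Definition two_sites (C : pred (seq nat)) (s : seq nat) : Prop :=
  exists k, [/\ C s, 1 < k <= size s, ~~ first_min s k &
    forall j, j <= size s -> C (ins j s) = (j == 0) || (j == k)].

Lemma descendants_two_sites C m s k : 1 < k <= size s ->
  (forall j, j <= size s -> C (ins j s) = (j == 0) || (j == k)) ->
  descendants C m.+1 s = descendants C m (ins 0 s) + descendants C m (ins k s).
Proof.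
move=> hk hC /=; rewrite big_ltn // hC //=; congr (_ + _).
rewrite (@big_nat_single _ _ k); first by rewrite hC ?eqxx ?orbT //; lia.
- lia.
by move=> i hi hne; rewrite hC; [rewrite (negbTE hne); case: eqP => //; lia|lia].
Qed.

(** * The generating tree of Av(2413, 2134, 1234) *)

Lemma A_ins_ins s i j : 1 < i <= size s -> A (ins i s) -> j <= (size s).+1 ->
  A (ins j (ins i s)) = [|| j == 0, j == i | (j == 1) && first_min s i].
Proof.
move=> hi hA hj; have hi' : i <= size s by lia.
have [-> | j0] := eqVneq j 0; first by rewrite A_ins0.
have [-> | ji] := eqVneq j i; first by rewrite A_ins_same.
have [-> | j1] := eqVneq j 1; first by rewrite A_ins1.
have [lt | lt] := ltnP j i; first by rewrite A_ins_mid //; lia.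
case: j hj j0 ji j1 lt => // j *; rewrite A_ins_right //; last lia.
by have -> : i <= 1 = false by lia.
Qed.

Lemma A_two_sites s i : 1 < i <= size s -> A (ins i s) -> ~~ first_min s i ->
  two_sites A (ins i s).
Proof.
move=> hi hA hf; exists i; split=> //; rewrite ?size_ins; first by lia.
  by rewrite first_min_ins //; lia.
by move=> j hj; rewrite A_ins_ins // (negbTE hf) andbF orbF.
Qed.

Record A_state (s : seq nat) (j l : nat) : Prop := AState {
  A_state_av : A s;
  A_state_size : 0 < size s;
  A_state_site1 : A (ins 1 s);
  A_state_min : \sum_(2 <= i < (size s).+1) (A (ins i s) && first_min s i) = j;
  A_state_nonmin :
    \sum_(2 <= i < (size s).+1) (A (ins i s) && ~~ first_min s i) = l }.

Lemma A_ins_ins0 s j : j <= size s -> A s -> A (ins j.+1 (ins 0 s)) = A (ins j s).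
Proof. by move=> hj hs; rewrite A_ins_right //; exact: A_ins0. Qed.

(** The child starts with its maximum, so none of its sites from 2 on is minimal. These sites are
    the old sites from 1 on, shifted by one. *)
Lemma A_state_ins0 s : 0 < size s -> A s ->
  A_state (ins 0 s) 0 (\sum_(1 <= i < (size s).+1) A (ins i s)).
Proof.
move=> h0 hs; have hp := A_perm hs; split; rewrite ?size_ins //.
- exact: A_ins0.
- by rewrite A_ins_ins0 // A_ins0.
- by apply: big_nat_zero => i hi; rewrite first_min_ins0 ?andbF //; lia.
rewrite big_add1 /=; apply: eq_big_nat => i hi.
by rewrite A_ins_ins0 ?first_min_ins0 ?andbT //; lia.
Qed.

(** Old sites from 1 on shift by one and keep their kind. Old site 1 becomes site 2, where the first
    entry is still least, and this accounts for the increment of [j]. *)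
Lemma A_state_ins1 s j l : A_state s j l -> A_state (ins 1 s) j.+1 l.
Proof.
case=> hs h0 h1 <- <-; have hp := A_perm hs.
have E i : 1 <= i < (size s).+1 -> A (ins i.+1 (ins 1 s)) = A (ins i s).
  by move=> hi; rewrite A_ins_right //; lia.
split; rewrite ?size_ins //.
- exact: A_ins_same.
- rewrite big_add1 /= big_ltn // E // h1 first_min_ins1 // first_min1 /= add1n; congr _.+1.
  by apply: eq_big_nat => i hi; rewrite E ?first_min_ins1 //; lia.
- rewrite big_add1 /= big_ltn // E // h1 first_min_ins1 // first_min1 /= add0n.
  by apply: eq_big_nat => i hi; rewrite E ?first_min_ins1 //; lia.
Qed.

Lemma A_state_ins s i : 1 < i <= size s -> A (ins i s) -> first_min s i ->
  A_state (ins i s) 1 0.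
Proof.
move=> hi hA hf; have hi' : i <= size s by lia.
split; rewrite ?size_ins //.
- by rewrite A_ins_ins // hf orbT.
- rewrite (@big_nat_single _ _ i); last first.
  + by move=> x hx hne; rewrite A_ins_ins ?(negbTE hne) ?hf; lia.
  + lia.
  by rewrite A_ins_same // first_min_ins // hf.
apply: big_nat_zero => x hx; rewrite A_ins_ins ?hf //; last lia.
have [-> | ne] := eqVneq x i; first by rewrite first_min_ins // hf andbF.
by case: eqP => [|_]; [lia|case: eqP => [|_] //; lia].
Qed.

(* [coefs m = (a, b, c, d)]: a node T(j,l) has [a + b * j + c * l] descendants
   [m] levels below, and a node S has [d]. *)
Fixpoint coefs (m : nat) : nat * nat * nat * nat :=
  if m is m'.+1 then
    let: (a, b, c, d) := coefs m' in
    (2 * a + b + c, a + 2 * b + c, 2 * c + d, a + c + d)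
  else (1, 0, 0, 1).

(** Affinity persists because the first two children have labels affine in [j] and [l], while the
    children occurring [j] or [l] times have the fixed types T(1,0) and S. *)
Lemma A_descendants m : let: (a, b, c, d) := coefs m in
  (forall s j l, A_state s j l -> descendants A m s = a + b * j + c * l) /\
  (forall s, two_sites A s -> descendants A m s = d).
Proof.
elim: m => [|m] /=; first by split=> // *; lia.
case: (coefs m) => [[[a b] c] d] [IHT IHS]; split.
- move=> s j l hst; have [hs h0 h1 hj hl] := hst.
  rewrite big_ltn // big_ltn // A_ins0 // h1.
  rewrite (IHT _ _ _ (A_state_ins0 h0 hs)) (IHT _ _ _ (A_state_ins1 hst)).
  rewrite big_ltn // h1 /=.
  have -> : \sum_(2 <= i < (size s).+1) A (ins i s) = j + l.
    rewrite -hj -hl -big_split /=; apply: eq_bigr => i _.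
    by case: (A _) (first_min _ _) => [] [].
  have -> : \sum_(2 <= i < (size s).+1)
      (if A (ins i s) then descendants A m (ins i s) else 0) = (a + b) * j + d * l.
    rewrite -hj -hl !big_distrr -big_split /=; apply: eq_big_nat => i hi.
    case: ifP => hA /=; last by rewrite !muln0.
    case hf: (first_min s i) => /=.
      by rewrite (IHT _ 1 0) ?muln1 ?muln0 ?addn0 //; apply: A_state_ins.
    by rewrite (IHS (ins i s)) ?muln1 ?muln0 //; apply: A_two_sites; rewrite ?hf.
  lia.
move=> s [k [hs hk hf hC]]; rewrite -/(descendants A m.+1 s).
rewrite (descendants_two_sites m hk hC) (IHS (ins k s)); last first.
  by apply: A_two_sites => //; rewrite hC ?eqxx ?orbT //; lia.
have h0 : 0 < size s by lia.
(* Beyond site 0 only [k] is active, so the child at site 0 is T(0,1). *)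
rewrite (IHT _ _ _ (A_state_ins0 h0 hs)) (@big_nat_single _ _ k).
- rewrite hC ?eqxx ?orbT /=; lia.
- lia.
by move=> i hi hne; rewrite hC ?(negbTE hne); lia.
Qed.

(** * The generating tree of Av(2413, 2134, 1324, 12534) *)

Lemma B_ins_right_nonmin s i j : i <= j <= size s -> B (ins i s) ->
  ~~ first_min s i -> B (ins j.+1 (ins i s)) = false.
Proof.
move=> hj hB hf; apply: contraNF hf => /(B_ins_right hj hB) [_ inc _].
by apply/first_minP => -[|y] // hy; apply/ltnW/inc.
Qed.

Lemma B_two_sites s i : 1 < i <= size s -> B (ins i s) -> ~~ first_min s i ->
  two_sites B (ins i s).
Proof.
move=> hi hB hf; have hi' : i <= size s by lia.
exists i; split=> //; rewrite ?size_ins; first by lia.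
  by rewrite first_min_ins.
move=> j hj; have [-> | j0] := eqVneq j 0; first by rewrite B_ins0.
have [-> | ji] := eqVneq j i; first by rewrite B_ins_same.
have [-> | j1] := eqVneq j 1; first by rewrite B_ins1 // (negbTE hf).
have [lt | lt] := ltnP j i; first by rewrite B_ins_mid //; lia.
by case: j hj j0 ji j1 lt => // j *; rewrite B_ins_right_nonmin //; lia.
Qed.

(** The last field serves twice: it is the condition of [B_ins_right] that keeps the sites beyond
    [p] active after an insertion at [p], and it shows that the first entry is not least before such
    a site, so that inserting there gives S. *)
Record B_state (s : seq nat) (p r : nat) : Prop := BState {
  B_state_av : B s;
  B_state_size : 0 < p <= size s;
  B_state_run : forall x y, x < y < p -> nth 0 s x < nth 0 s y;
  B_state_sites : forall i, i <= p ->
    B (ins i s) = [|| i == 0, i == 1, i == p.-1 | i == p];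
  B_state_count : \sum_(p.+1 <= i < (size s).+1) B (ins i s) = r;
  B_state_below : forall i x y, i <= size s -> B (ins i s) ->
    x < p <= y -> y < i -> nth 0 s y < nth 0 s x }.

Lemma B_ins_ins0 s j : j <= size s -> B s -> B (ins j.+1 (ins 0 s)) = B (ins j s).
Proof.
move=> hj hs; have h0 : 0 <= j <= size s by [].
apply/idP/idP => [/(B_ins_right h0 (B_ins0 hs)) [] // | h].
by apply/(B_ins_right h0 (B_ins0 hs)); split=> // x y; lia.
Qed.

Lemma B_state_ins0 s : 0 < size s -> B s ->
  B_state (ins 0 s) 1 (\sum_(1 <= i < (size s).+1) B (ins i s)).
Proof.
move=> h0 hs; have hp := B_perm hs; split; rewrite ?size_ins //.
- exact: B_ins0.
- by move=> x y; lia.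
- move=> [|[|i]] // _; first by rewrite B_ins0 // B_ins0.
  by rewrite B_ins_ins0 // B_ins0.
- by rewrite big_add1 /=; apply: eq_big_nat => i hi; rewrite B_ins_ins0 //; lia.
move=> i [|x] [|y] // _ _ _ _.
by rewrite nth_ins_eq // nth_ins_gt // ltnS permutation_bound.
Qed.

(** The new maximum extends the first [q] entries to an increasing prefix of length [q.+1]. For
    [q < p] the old entry at [q] exceeds the first one, so by [B_ins_right] no site beyond [q.+1]
    survives; for [q = p] all [r] of them do. *)
Lemma B_state_ins_run s p r q : B_state s p r -> 0 < q <= p -> B (ins q s) ->
  B_state (ins q s) q.+1 (if q == p then r else 0).
Proof.
case=> hs hp inc sites hr below hq hB; have hqs : q <= size s by lia.
have bd x : nth 0 s x < (size s).+1 by exact: permutation_bound (B_perm hs).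
have fm : first_min s q.
  by apply/first_minP => -[|y] // hy; apply/ltnW/inc; lia.
have R j : q <= j <= size s -> B (ins j.+1 (ins q s)) ->
    B (ins j s) /\ (q < j -> q = p).
  move=> hj /(B_ins_right hj hB) [-> _ lt]; split=> // qj.
  have [//|qp] := eqVneq q p.
  have := lt 0 q; have := inc 0 q; lia.
split; rewrite ?size_ins //.
- move=> x y hxy.
  case_ins x hqs x1; case_ins y hqs y1; try lia;
  move: (inc x1 y1) (bd x1); lia.
- move=> i hi.
  have [-> | i0] := eqVneq i 0; first by rewrite B_ins0.
  have [-> | iq] := eqVneq i q; first by rewrite B_ins_same //= ?eqxx /= orbT.
  have [-> | iq1] := eqVneq i q.+1.
    (* At the site just after the new maximum no entry lies between the two maxima, so the last
       condition is vacuous. *)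
    rewrite !orbT; apply/B_ins_right => //; first lia.
    by split=> // x y; [move=> ?; apply: inc|]; lia.
  have [-> | i1] := eqVneq i 1; first by rewrite B_ins1 // ?fm; lia.
  by rewrite B_ins_mid //; lia.
- rewrite big_add1 /=; case: eqP => [e | /eqP ne].
    rewrite -hr e; apply: eq_big_nat => i hi; congr nat_of_bool.
    have hpi : p <= i <= size s by lia.
    rewrite -e in hpi *; apply/idP/idP => [/(R _ hpi) [] // | hBi].
    apply/B_ins_right => //; split=> // x y hx; [apply: inc; lia|move=> hy].
    by apply: (below i) => //; lia.
  apply: big_nat_zero => i hi; apply/eqP; rewrite eqb0; apply/negP => h.
  by have [|_] := R i _ h; lia.
move=> [|i] x y // hi hBi hx hy.
have hqi : q <= i <= size s by lia.
have [hBi' qp] := R _ hqi hBi.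
have {}qp : q = p by apply: qp; lia.
case_ins x hqs x1; case_ins y hqs y1; try lia;
move: (bd y1) (below i x1 y1) => // ? h; (try apply: h => //); lia.
Qed.

Lemma B_state_ins_last s p r i : B_state s p r -> p < i <= size s -> B (ins i s) ->
  two_sites B (ins i s).
Proof.
case=> hs hp inc sites hr below hi hB; apply: B_two_sites => //; first lia.
apply/negP => /first_minP /(_ p); have := below i 0 p; lia.
Qed.

Lemma B_descendants m : let: (a, b, c, d) := coefs m in
  (forall s p r, B_state s p r ->
     descendants B m s = a + b * minn p.-1 2 + c * r) /\
  (forall s, two_sites B s -> descendants B m s = d).
Proof.
elim: m => [|m] /=; first by split=> // *; lia.
case: (coefs m) => [[[a b] c] d] [IHT IHS]; split.
- move=> s p r hst; have [hs hp inc sites hr below] := hst.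
  have h0 : 0 < size s by lia.
  have hp0 : 0 < p by lia.
  have run q : 0 < q <= p -> B (ins q s) -> _ :=
    fun hq hB => IHT _ _ _ (B_state_ins_run hst hq hB).
  have s1 : B (ins 1 s) by rewrite sites //= .
  have sp : B (ins p s) by rewrite sites // eqxx !orbT.
  have sp1 : B (ins p.-1 s) by rewrite sites ?eqxx ?orbT //; lia.
  rewrite big_ltn // B_ins0 // (IHT _ _ _ (B_state_ins0 h0 hs)).
  have cat (F : nat -> nat) : \sum_(1 <= i < (size s).+1) F i =
      \sum_(1 <= i < p.+1) F i + \sum_(p.+1 <= i < (size s).+1) F i.
    by rewrite (@big_cat_nat _ _ _ p.+1) //; lia.
  rewrite !cat.
  have dead i : 1 < i < p.-1 -> B (ins i s) = false.
    by move=> hi; rewrite sites; lia.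
  rewrite !big_nat_run //; try by move=> i /dead ->.
  rewrite hr s1 sp sp1 (run 1) // (run p) //; last lia.
  have -> : \sum_(p.+1 <= i < (size s).+1)
      (if B (ins i s) then descendants B m (ins i s) else 0) = d * r.
    rewrite -hr big_distrr /=; apply: eq_big_nat => i hi.
    case: ifP => hB /=; last by rewrite muln0.
    by rewrite (IHS (ins i s)) ?muln1 //; apply: B_state_ins_last hst _ hB; lia.
  have E : 2 < p -> descendants B m (ins p.-1 s) = a + b * minn p.-1 2.
    by move=> h; rewrite run //; [case: eqP|]; lia.
  (* The cases [p = 1], [p = 2] and [p >= 3] are the three rules; in the last one the truncation at
     2 gives [p] and [p.+1] the same value. *)
  move: E hp0; clear; case: p => [|[|[|p]]] //=; rewrite ?eqxx; try lia.
move=> s [k [hs hk hf hC]]; rewrite -/(descendants B m.+1 s).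
rewrite (descendants_two_sites m hk hC) (IHS (ins k s)); last first.
  by apply: B_two_sites => //; rewrite hC ?eqxx ?orbT //; lia.
have h0 : 0 < size s by lia.
rewrite (IHT _ _ _ (B_state_ins0 h0 hs)) (@big_nat_single _ _ k).
- rewrite hC ?eqxx ?orbT /=; lia.
- lia.
by move=> i hi hne; rewrite hC ?(negbTE hne); lia.
Qed.

(** * Roots of the trees and conclusion *)

Lemma A_short s : size s < 4 -> is_permutation s -> A s.
Proof. by move=> h hp; apply/AP; split=> // x y z w; lia. Qed.

Lemma B_short s : size s < 4 -> is_permutation s -> B s.
Proof. by move=> h hp; apply/BP; split=> //; split=> [x y z w|x y z w v]; lia. Qed.

Theorem theorem11p1 :
  wilf_equivalent
    (Av [:: [:: 2; 4; 1; 3]; [:: 2; 1; 3; 4]; [:: 1; 2; 3; 4]])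
    (Av [:: [:: 2; 4; 1; 3]; [:: 2; 1; 3; 4]; [:: 1; 3; 2; 4];
            [:: 1; 2; 5; 3; 4]]).
Proof.
(* Labels require a nonempty word, so size 0 is checked directly and both trees are rooted at
   [[:: 1]]. *)
rewrite -/A -/B => -[|m].
  by rewrite /class_count /= A_short // B_short.
have p1 : permutations (iota 1 1) = [:: [:: 1]] by [].
rewrite -addn1 !class_count_descendants; try by [move=> i s; exact: Av_ins].
rewrite p1 !big_cons !big_nil A_short // B_short // !addn0.
(* The roots are T(0,0) and U(1,0); as [minn 0 2 = 0], both counts equal the constant coefficient
   [a]. *)
have sA : A_state [:: 1] 0 0.
  by split; rewrite ?big_geq // A_short.
have sB : B_state [:: 1] 1 0.
  split; rewrite ?big_geq ?B_short //; first by move=> x y; lia.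
  - by move=> [|[|i]] // _; rewrite B_short.
  - by move=> i x y /=; lia.
have := (A_descendants m, B_descendants m).
case: (coefs m) => [[[a b] c] d] [[hA _] [hB _]].
by rewrite (hA _ _ _ sA) (hB _ _ _ sB).
Qed.
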